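(* Let $A$ be an $\ell$-controllable complete group system with generator group $(\mathcal{U},\circ)$, and let $\mathcal{E}_A$ be the $(\ell+1)$-depth elementary system with elementary set $\mathcal{U}$ and elementary list $\{(\nabla_{0,k}^t(\mathcal{U}),\circledcirc_{0,k}^t):0\le k\le\ell,\ t\in\mathbf{Z}\}$. Form the $(\ell+1)$-depth global group $(\mathcal{U},\star)$ of $\mathcal{E}_A$. Then for all $\dot{\mathbf{u}},\ddot{\mathbf{u}}\in\mathcal{U}$ the product $\dot{\mathbf{u}}\star\ddot{\mathbf{u}}$ in $(\mathcal{U},\star)$ is the same as the product $\dot{\mathbf{u}}\circ\ddot{\mathbf{u}}$ in $(\mathcal{U},\circ)$. Therefore there is an isomorphism $(\mathcal{U},\star)\simeq(\mathcal{U},\circ)$ given by the identity map of $\mathcal{U}$.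
   Context: Let $(A^t)_{t\in\mathbf{Z}}$ be finite groups. A group system $A$ is a set of sequences $\mathbf{a}=(a^t)_{t\in\mathbf{Z}}$, $a^t\in A^t$, forming a group under componentwise operation, such that every element of $A^t$ occurs as a time-$t$ component, for each $t$. $\chi^t:A\to A^t$ is $\mathbf{a}\mapsto a^t$. $A$ is $\ell$-controllable ($\ell>0$) if for every $t\in\mathbf{Z}$ and all $\dot{\mathbf{a}},\ddot{\mathbf{a}}\in A$ there is $\mathbf{a}\in A$ agreeing with $\dot{\mathbf{a}}$ at all times $<t$ and with $\ddot{\mathbf{a}}$ at all times $\ge t+\ell$. $A$ is complete if every sequence in $\prod_t A^t$ whose restriction to each finite interval is the restriction of some element of $A$ belongs to $A$. $A^{[m,n]}$ is the set of sequences in $A$ that are the identity outside $[m,n]$. $X^t$ (resp. $Y^t$) is the normal subgroup of sequences in $A$ that are the identity at all times $<t$ (resp. $>t$). Basis: for $t\in\mathbf{Z}$, $0\le k\le\ell$ put $\Lambda^{[t,t+k]}=X^{t+1}(X^t\cap Y^{t+k})/X^{t+1}(X^t\cap Y^{t+k-1})$. A basis is a choice, for each $(k,t)$, of a transversal $[\Lambda^{[t,t+k]}]$ whose elements (generators $\mathbf{g}^{[t,t+k]}$) lie in $A^{[t,t+k]}$ and in which the trivial coset is represented by the identity sequence. $\mathcal{R}=\prod_{t\in\mathbf{Z}}\prod_{0\le k\le\ell}[\Lambda^{[t,t+k]}]$. The map $\alpha:\mathcal{R}\to A$ sends $\mathbf{r}=(\mathbf{g}^{[t,t+k]})_{k,t}$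 to $\prod_{i=+\infty}^{-\infty}\prod_{m=0}^{\ell}\mathbf{g}^{[i,i+m]}$, i.e. the sequence with time-$t$ component $\prod_{j=0}^{\ell}\bigl(\prod_{k=j}^{\ell}\chi^t(\mathbf{g}^{[t-j,t-j+k]})\bigr)$ (factors written left to right in increasing $j$, and increasing $k$ for each $j$); $\alpha$ is a bijection. The operation $*$ on $\mathcal{R}$ is $\dot{\mathbf{r}}*\ddot{\mathbf{r}}=\alpha^{-1}(\alpha(\dot{\mathbf{r}})\alpha(\ddot{\mathbf{r}}))$. For each $(k,t)$ let $G_k^t$ be a set of labels with a fixed bijection $[\Lambda^{[t,t+k]}]\to G_k^t$, $\mathbf{g}^{[t,t+k]}\mapsto g_k^t$. $\mathcal{U}=\prod_{t\in\mathbf{Z}}\prod_{0\le k\le\ell}G_k^t$, and $\beta:\mathcal{R}\to\mathcal{U}$ replaces each generator by its label. The operation $\circ$ on $\mathcal{U}$ is $\beta(\dot{\mathbf{r}})\circ\beta(\ddot{\mathbf{r}})=\beta(\dot{\mathbf{r}}*\ddot{\mathbf{r}})$; $(\mathcal{U},\circ)$ is the generator group. Upper triangles: for $t\in\mathbf{Z}$, $0\le k\le\ell$ let $T_k^t=\{(m,t-j):0\le j\le\ell-k,\ k+j\le m\le\ell\}$. For an element $\mathbf{w}=(w_m^s)_{0\le m\le\ell,s\in\mathbf{Z}}$ of a double Cartesian product $\mathcal{W}=\prod_{s\in\mathbf{Z}}\prod_{0\le m\le\ell}W_m^s$, $\nabla_{0,k}^t(\mathbf{w})=(w_m^s)_{(m,s)\in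 T_k^t}$, and $\nabla_{0,k}^t(\mathcal{W})=\{\nabla_{0,k}^t(\mathbf{w}):\mathbf{w}\in\mathcal{W}\}$. The upper elementary group $(\nabla_{0,k}^t(\mathcal{U}),\circledcirc_{0,k}^t)$ has the (well-defined) operation $\nabla_{0,k}^t(\dot{\mathbf{u}})\circledcirc_{0,k}^t\nabla_{0,k}^t(\ddot{\mathbf{u}})=\nabla_{0,k}^t(\dot{\mathbf{u}}\circ\ddot{\mathbf{u}})$. An $(\ell+1)$-depth elementary system consists of an elementary set $\mathcal{V}=\prod_{t\in\mathbf{Z}}\prod_{0\le k\le\ell}V_k^t$, and groups $(\nabla_{0,k}^t(\mathcal{V}),\odot_{0,k}^t)$, $0\le k\le\ell$, $t\in\mathbf{Z}$ (the elementary list), such that for each $0\le k<\ell$ and $t\in\mathbf{Z}$ the projections $\nabla_{0,k}^t(\mathbf{v})\mapsto\nabla_{0,k+1}^t(\mathbf{v})$ and $\nabla_{0,k}^t(\mathbf{v})\mapsto\nabla_{0,k+1}^{t-1}(\mathbf{v})$ are homomorphisms to the corresponding groups of the list. Its global group is $\mathcal{V}$ with the operation sending $(\dot{\mathbf{v}},\ddot{\mathbf{v}})$ to the unique $\bar{\mathbf{v}}\in\mathcal{V}$ with $\nabla_{0,0}^t(\bar{\mathbf{v}})=\nabla_{0,0}^t(\dot{\mathbf{v}})\odot_{0,0}^t\nabla_{0,0}^t(\ddot{\mathbf{v}})$ for all $t\in\mathbf{Z}$. *)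

(* Defs.v *)
From HB Require Import structures.
From mathcomp Require Import all_boot all_order all_algebra all_fingroup.
From mathcomp Require Import boolp classical_sets functions.

Set Implicit Arguments.
Unset Strict Implicit.
Unset Printing Implicit Defensive.

Import Order.TTheory GRing.Theory Num.Theory.
Local Open Scope classical_set_scope.
Local Open Scope ring_scope.

Definition group_on (T : Type) (D : set T) (op : T -> T -> T) : Prop :=
  [/\ forall x y, D x -> D y -> D (op x y),
      forall x y z, D x -> D y -> D z -> op x (op y z) = op (op x y) z &
      exists2 e, D e & forall x, D x ->
        [/\ op e x = x, op x e = x &
            exists y, [/\ D y, op y x = e & op x y = e]]].

Definition group_hom_on (T T' : Type) (D : set T) (op : T -> T -> T)
    (D' : set T') (op' : T' -> T' -> T') (f : T -> T') : Prop :=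
  (forall x, D x -> D' (f x)) /\
  (forall x y, D x -> D y -> f (op x y) = op' (f x) (f y)).

Definition group_isom (T T' : Type) (op : T -> T -> T) (op' : T' -> T' -> T')
    (f : T -> T') : Prop :=
  [/\ group_on setT op, group_on setT op', bijective f &
      group_hom_on setT op setT op' f].

(* The operation on the range of [f] determined by
   [op' (f x1) (f x2) = f (op x1 x2)], when that is well defined; outside the
   range of [f] the value is irrelevant. *)
Definition induced_op (T : Type) (T' : choiceType) (f : T -> T')
    (op : T -> T -> T) (y1 y2 : T') : T' :=
  xget y1 [set y | exists x1 x2,
                   [/\ f x1 = y1, f x2 = y2 & y = f (op x1 x2)]].

Definition sequences (Alph : int -> finGroupType) : Type := forall t, Alph t.

Section SequenceGroup.
Variable Alph : int -> finGroupType.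
Implicit Types a b c : sequences Alph.

Definition seq_one : sequences Alph := fun t => 1%g.
Definition seq_mul a b : sequences Alph := fun t => (a t * b t)%g.
Definition seq_inv a : sequences Alph := fun t => ((a t)^-1)%g.

Lemma seq_mulA : associative seq_mul.
Proof. by move=> a b c; apply: functional_extensionality_dep => t; exact: mulgA. Qed.
Lemma seq_mul1 : left_id seq_one seq_mul.
Proof. by move=> a; apply: functional_extensionality_dep => t; exact: mul1g. Qed.
Lemma seq_mulr1 : right_id seq_one seq_mul.
Proof. by move=> a; apply: functional_extensionality_dep => t; exact: mulg1. Qed.
Lemma seq_mulV : left_inverse seq_one seq_inv seq_mul.
Proof. by move=> a; apply: functional_extensionality_dep => t; exact: mulVg. Qed.
Lemma seq_mulrV : right_inverse seq_one seq_inv seq_mul.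
Proof. by move=> a; apply: functional_extensionality_dep => t; exact: mulgV. Qed.

HB.instance Definition _ := gen_eqMixin (sequences Alph).
HB.instance Definition _ := gen_choiceMixin (sequences Alph).
HB.instance Definition _ := isGroup.Build (sequences Alph)
  seq_mulA seq_mul1 seq_mulr1 seq_mulV seq_mulrV.

End SequenceGroup.

Section GroupSystem.
Variable Alph : int -> finGroupType.
Implicit Type A : set (sequences Alph).

Definition group_system A : Prop :=
  group_on A (fun a b => (a * b)%g) /\
  forall (t : int) (x : Alph t), exists2 a, A a & a t = x.

Definition controllable (l : nat) A : Prop :=
  forall t a1 a2, A a1 -> A a2 ->
    exists a, [/\ A a, forall s, s < t -> a s = a1 s &
                  forall s, t + l%:Z <= s -> a s = a2 s].

Definition complete_system A : Prop :=
  forall b : sequences Alph,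
    (forall m n : int, exists2 a, A a & forall t, m <= t <= n -> a t = b t) ->
    A b.

Definition Aint A (m n : int) : set (sequences Alph) :=
  [set a | A a /\ forall s, ~~ (m <= s <= n) -> a s = 1%g].

Definition Xset A (t : int) : set (sequences Alph) :=
  [set a | A a /\ forall s, s < t -> a s = 1%g].

Definition Yset A (t : int) : set (sequences Alph) :=
  [set a | A a /\ forall s, t < s -> a s = 1%g].

Definition mulset (P Q : set (sequences Alph)) : set (sequences Alph) :=
  [set (a * b)%g | a in P & b in Q].

Definition left_coset (a : sequences Alph) (Q : set (sequences Alph)) :
    set (sequences Alph) :=
  [set (a * b)%g | b in Q].

Definition cosets (P Q : set (sequences Alph)) : set (set (sequences Alph)) :=
  [set left_coset a Q | a in P].

Definition Lambda A (t : int) (k : nat) : set (set (sequences Alph)) :=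
  cosets (mulset (Xset A (t + 1)) (Xset A t `&` Yset A (t + k%:Z)))
         (mulset (Xset A (t + 1)) (Xset A t `&` Yset A (t + k%:Z - 1))).

Definition transversal_of (C : set (set (sequences Alph)))
    (B : set (sequences Alph)) : Prop :=
  (forall g, B g -> exists2 c, C c & c g) /\
  (forall c, C c -> exists! g, B g /\ c g).

(* [B k t] is the transversal [Lambda^[t,t+k]]; as it contains the identity
   sequence, that sequence is the representative of the trivial coset. *)
Definition is_basis (l : nat) A
    (B : 'I_l.+1 -> int -> set (sequences Alph)) : Prop :=
  forall (k : 'I_l.+1) (t : int),
    [/\ transversal_of (Lambda A t k) (B k t),
        B k t `<=` Aint A t (t + k%:Z) & B k t 1%g].

End GroupSystem.

Definition double_prod (l : nat) (W : 'I_l.+1 -> int -> Type) : Type :=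
  forall (m : 'I_l.+1) (s : int), W m s.

HB.instance Definition _ (l : nat) (W : 'I_l.+1 -> int -> Type) :=
  gen_eqMixin (double_prod W).
HB.instance Definition _ (l : nat) (W : 'I_l.+1 -> int -> Type) :=
  gen_choiceMixin (double_prod W).

(* Indices are pairs (m, s) with s = t - j; for k > l the triangle is empty. *)
Definition Tri (l k : nat) (t : int) : pred ('I_l.+1 * int) :=
  fun p => [exists j : 'I_(l - k).+1, (p.2 == t - j%:Z) && (k + j <= p.1)%N].

Definition triangle (l : nat) (W : 'I_l.+1 -> int -> Type) (k : nat) (t : int)
    : Type :=
  forall p : {p : 'I_l.+1 * int | Tri k t p}, W (sval p).1 (sval p).2.

HB.instance Definition _ (l : nat) (W : 'I_l.+1 -> int -> Type) k t :=
  gen_eqMixin (triangle W k t).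
HB.instance Definition _ (l : nat) (W : 'I_l.+1 -> int -> Type) k t :=
  gen_choiceMixin (triangle W k t).

Definition nabla (l : nat) (W : 'I_l.+1 -> int -> Type) (k : nat) (t : int)
    (w : double_prod W) : triangle W k t :=
  fun p => w (sval p).1 (sval p).2.
Arguments nabla {l W} k t w p.

Definition nabla_set (l : nat) (W : 'I_l.+1 -> int -> Type) (k : nat) (t : int)
    : set (triangle W k t) :=
  range (@nabla l W k t).
Arguments nabla_set {l} W k t _.

Lemma Tri_up (l k : nat) (t : int) (p : 'I_l.+1 * int) :
  (k < l)%N -> Tri k.+1 t p -> Tri k t p.
Proof.
move=> kl /existsP[j /andP[/eqP p2 p1]]; apply/existsP.
have jP : (j < (l - k).+1)%N.
  by apply: leq_trans (ltn_ord j) _; rewrite ltnS leq_sub2l.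
exists (Ordinal jP); rewrite /= p2 eqxx /=.
by apply: leq_trans p1; rewrite leq_add2r.
Qed.

Lemma Tri_left (l k : nat) (t : int) (p : 'I_l.+1 * int) :
  (k < l)%N -> Tri k.+1 (t - 1) p -> Tri k t p.
Proof.
move=> kl /existsP[j /andP[/eqP p2 p1]]; apply/existsP.
have jP : (j.+1 < (l - k).+1)%N.
  by rewrite ltnS; apply: leq_trans (ltn_ord j) _; rewrite subnS prednK ?subn_gt0.
exists (Ordinal jP); apply/andP; split; last by rewrite /= addnS -addSn.
by rewrite /= p2 -addrA -opprD -PoszD add1n.
Qed.

Definition tri_restrict (l : nat) (W : 'I_l.+1 -> int -> Type) (k k' : nat)
    (t t' : int) (sub : forall p, @Tri l k' t' p -> @Tri l k t p)
    (x : triangle W k t) : triangle W k' t' :=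
  fun p => x (exist _ (sval p) (sub _ (proj2_sig p))).

Definition proj_up (l : nat) (W : 'I_l.+1 -> int -> Type) (k : nat) (t : int)
    (kl : (k < l)%N) : triangle W k t -> triangle W k.+1 t :=
  tri_restrict (fun p => @Tri_up l k t p kl).

Definition proj_left (l : nat) (W : 'I_l.+1 -> int -> Type) (k : nat) (t : int)
    (kl : (k < l)%N) : triangle W k t -> triangle W k.+1 (t - 1) :=
  tri_restrict (fun p => @Tri_left l k t p kl).

(* Only the entries with k <= l are constrained by [elementary_system]. *)
Definition list_op (l : nat) (V : 'I_l.+1 -> int -> Type) : Type :=
  forall (k : nat) (t : int), triangle V k t -> triangle V k t -> triangle V k t.

Definition elementary_system (l : nat) (V : 'I_l.+1 -> int -> Type)
    (op : list_op V) : Prop :=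
  (forall (k : nat) (t : int), (k <= l)%N ->
     group_on (nabla_set V k t) (op k t)) /\
  (forall (k : nat) (t : int) (kl : (k < l)%N),
     group_hom_on (nabla_set V k t) (op k t)
       (nabla_set V k.+1 t) (op k.+1 t)
       (@proj_up l V k t kl) /\
     group_hom_on (nabla_set V k t) (op k t)
       (nabla_set V k.+1 (t - 1)) (op k.+1 (t - 1))
       (@proj_left l V k t kl)).

Definition is_global_product (l : nat) (V : 'I_l.+1 -> int -> Type)
    (op : list_op V) (v1 v2 v : double_prod V) : Prop :=
  forall t, nabla 0 t v = op 0%N t (nabla 0 t v1) (nabla 0 t v2).

(* When [op] is an elementary system the product exists and is unique, see
   [global_product_unique] and [global_opP]. *)
Definition global_op (l : nat) (V : 'I_l.+1 -> int -> Type)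
    (op : list_op V) (v1 v2 : double_prod V) : double_prod V :=
  xget v1 [set v | is_global_product op v1 v2 v].

Section GlobalProduct.
Variables (l : nat) (V : 'I_l.+1 -> int -> Type) (op : list_op V).
Hypothesis opP : elementary_system op.
Variables v1 v2 : double_prod V.

Let vprod k t : triangle V k t := @op k t (nabla k t v1) (nabla k t v2).
Arguments vprod : clear implicits.

Let triangle_irr k t (x : triangle V k t) p (H H' : @Tri l k t p) :
  x (exist _ p H) = x (exist _ p H').
Proof. by rewrite (bool_irrelevance H H'). Qed.

Let vprod_up k t p (H : @Tri l k t p) (H' : @Tri l k.+1 t p) : (k < l)%N ->
  vprod k t (exist _ p H) = vprod k.+1 t (exist _ p H').
Proof.
move=> kl; have [[_ hom] _] := opP.2 k t kl.
have /(congr1 (fun f : triangle V k.+1 t => f (exist _ p H'))) e :=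
  hom (nabla k t v1) (nabla k t v2)
    (ex_intro2 _ _ v1 I erefl) (ex_intro2 _ _ v2 I erefl).
rewrite (triangle_irr (vprod k t) H (Tri_up kl H')); exact: e.
Qed.

Let vprod_left k t t' p (H : @Tri l k t p) (H' : @Tri l k.+1 t' p) :
  t' = t - 1 -> (k < l)%N ->
  vprod k t (exist _ p H) = vprod k.+1 t' (exist _ p H').
Proof.
move=> tE kl; subst t'; have [_ [_ hom]] := opP.2 k t kl.
have /(congr1 (fun f : triangle V k.+1 (t - 1) => f (exist _ p H'))) e :=
  hom (nabla k t v1) (nabla k t v2)
    (ex_intro2 _ _ v1 I erefl) (ex_intro2 _ _ v2 I erefl).
rewrite (triangle_irr (vprod k t) H (Tri_left kl H')); exact: e.
Qed.

Let Tri_diag (m : 'I_l.+1) (s : int) (j : nat) :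
  (j <= m)%N -> Tri j s (m, s).
Proof.
by move=> jm; apply/existsP; exists ord0; rewrite /= subr0 eqxx addn0.
Qed.

Let Tri_off (m : 'I_l.+1) (s : int) (i j : nat) : (i + j <= m)%N ->
  Tri j (s + i%:Z) (m, s).
Proof.
move=> ijm; apply/existsP; have il : (i < (l - j).+1)%N.
  by rewrite ltnS leq_subRL ?(addnC j) ?(leq_trans ijm) -1?ltnS //;
     rewrite (leq_trans _ (ltn_ord m)) // ltnS (leq_trans _ ijm) // leq_addl.
by exists (Ordinal il); rewrite /= addrK eqxx addnC.
Qed.

Let vprod_diag (m : 'I_l.+1) (s : int) (i j : nat)
    (H : @Tri l j (s + i%:Z) (m, s)) (H' : @Tri l (i + j) s (m, s)) :
  (i + j <= m)%N ->
  vprod j (s + i%:Z) (exist _ (m, s) H) = vprod (i + j) s (exist _ (m, s) H').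
Proof.
elim: i j H H' => [|i IH] j H H' ijm.
  move: H; rewrite addr0 => H; exact: triangle_irr.
have ijm' : (i + j.+1 <= m)%N by rewrite addnS -addSn.
have H1 := Tri_off s ijm'.
rewrite (vprod_left H H1).
- move: H'; rewrite addSnnS => H'; exact: IH.
- by rewrite -addn1 PoszD addrA addrK.
- by rewrite (leq_trans _ (leq_trans ijm' (ltn_ord m))) // leq_addl.
Qed.

Let vprod_vert (m : 'I_l.+1) (s : int) (i : nat)
    (H : @Tri l 0 s (m, s)) (H' : @Tri l i s (m, s)) : (i <= m)%N ->
  vprod 0 s (exist _ (m, s) H) = vprod i s (exist _ (m, s) H').
Proof.
elim: i H' => [|i IH] H' im.
  exact: triangle_irr.
have H1 := Tri_diag s (ltnW im).
rewrite (IH H1 (ltnW im)); apply: (vprod_up H1 H').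
by apply: leq_trans im _; rewrite -ltnS.
Qed.

Lemma global_product_unique : exists! v, is_global_product op v1 v2 v.
Proof.
exists (fun (m : 'I_l.+1) (s : int) => vprod 0 s (exist _ (m, s) (Tri_diag s (leq0n m)))).
split.
  move=> t; apply: functional_extensionality_dep => -[[m s] /= H].
  rewrite /nabla /=; have /existsP[/= i /andP[/eqP /= sE im]] := H.
  have tE : t = s + (i : nat)%:Z by rewrite sE subrK.
  rewrite add0n in im; clear sE; move: H; rewrite tE => H.
  have im' : (i + 0 <= m)%N by rewrite addn0.
  rewrite (vprod_vert _ (Tri_diag s im') im').
  exact/esym/(vprod_diag H).
move=> v' v'P; apply: functional_extensionality_dep => m.
apply: functional_extensionality_dep => s.
by rewrite /vprod -(v'P s).
Qed.

Lemma global_opP : is_global_product op v1 v2 (global_op op v1 v2).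
Proof.
have [v [vP _]] := global_product_unique.
exact: (@xgetPex _ v1 [set v | is_global_product op v1 v2 v] (ex_intro _ v vP)).
Qed.

End GlobalProduct.

Section GeneratorGroup.
Variables (l : nat) (Alph : int -> finGroupType).
Variable B : 'I_l.+1 -> int -> set (sequences Alph).

Definition gen_prod : Type := double_prod (fun k t => set_type (B k t)).
HB.instance Definition _ := Choice.on gen_prod.

Definition alpha (r : gen_prod) : sequences Alph :=
  fun t => (\prod_(j < l.+1) \prod_(k < l.+1 | (j <= k)%N)
              sval (r k (t - j%:Z)) t)%g.

(* For a basis of an l-controllable complete group system A, alpha is a bijection
   onto A, so that this is the only such r. *)
Definition gen_mul (r1 r2 : gen_prod) : gen_prod :=
  xget r1 [set r | alpha r = (alpha r1 * alpha r2)%g].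

Variables (G : 'I_l.+1 -> int -> Type).
Variable lab : forall k t, B k t -> G k t.

Definition beta (r : gen_prod) : double_prod G := fun k t => lab (r k t).

Definition generator_op : double_prod G -> double_prod G -> double_prod G :=
  induced_op beta gen_mul.

Definition upper_op : list_op G :=
  fun k t => induced_op (@nabla l G k t) generator_op.

End GeneratorGroup.

(* Main.v *)
(** Let [r = alpha^-1 a].  The triangle [nabla_{0,k}^t(r)] consists of the
    generators that start at time at most [t] and end at time at least [t+k].
    Cutting [alpha r] between the generators starting after [t] and the others
    shows that the triangle determines [a] modulo the normal subgroup
    [X^{t+1} Y^{t+k-1}].  Conversely, descending induction on the length of the
    generators shows that [a] modulo this subgroup determines the triangle; in
    particular [alpha] is injective.  So equality of triangles is a congruence
    of the generator group, the upper elementary groups are the quotients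
    [A / X^{t+1} Y^{t+k-1}], and the generator operation satisfies the equation
    that characterises the global product.

    Surjectivity of [alpha] is obtained by the same descending induction, where
    controllability provides the factorisations
    [A = X^T Y^{T+l-1}] to start from. *)

Require Import Defs.
From mathcomp Require Import all_boot all_order all_algebra all_fingroup.
From mathcomp Require Import boolp classical_sets functions.
From mathcomp Require Import zify.

Set Implicit Arguments.
Unset Strict Implicit.
Unset Printing Implicit Defensive.

Import Order.TTheory GRing.Theory Num.Theory.

(** * Ordered products in a noncommutative group *)

Lemma prod_split_downset (gT : groupType) (n : nat) (P : pred nat)
    (F : 'I_n -> gT) :
  (forall i j, (i <= j)%N -> P j -> P i) ->
  (\prod_(i < n) F i =
   \prod_(i < n | P i) F i * \prod_(i < n | ~~ P i) F i)%g.
Proof.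
move=> Pdown; elim: n F => [|n IH] F; first by rewrite !big_ord0 mulg1.
rewrite big_ord_recr (big_mkcond (fun i : 'I_n.+1 => P i)).
rewrite (big_mkcond (fun i : 'I_n.+1 => ~~ P i)) !big_ord_recr /=.
rewrite -!big_mkcond IH; case: ifP => Pn /=; last by rewrite mulg1 mulgA.
suff nP1 : (\prod_(i < n | ~~ P i) F (widen_ord (leqnSn n) i) = 1)%g.
  by rewrite nP1 !mulg1.
by apply: big1 => i /negP[]; apply: Pdown Pn; exact: ltnW.
Qed.

Lemma prod_split_at (gT : groupType) (n : nat) (c : 'I_n) (F : 'I_n -> gT) :
  (\prod_(i < n) F i =
   \prod_(i < n | (i < c)%N) F i * F c * \prod_(i < n | (c < i)%N) F i)%g.
Proof.
rewrite (@prod_split_downset _ _ (fun i => i <= c)%N); last first.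
  by move=> i j; exact: leq_trans.
congr (_ * _)%g; last by apply: eq_bigl => i; rewrite ltnNge.
rewrite big_mkcond (@prod_split_downset _ _ (fun i => i < c)%N); last first.
  by move=> i j; exact: leq_ltn_trans.
congr (_ * _)%g.
  by apply: eq_bigr => i ic; rewrite ltnW.
rewrite -big_mkcondr (big_pred1 c) // => i /=.
by rewrite -leqNgt -eqn_leq eq_sym.
Qed.

(** * Congruence modulo normal subgroups of a group of sequences *)

Section Congruence.
Context {Alph : int -> finGroupType}.
Implicit Types (A K : set (sequences Alph)) (a b x y : sequences Alph).

Local Open Scope group_scope.

Record subgroup_of K : Prop := SubgroupOf {
  sub1 : K 1;
  subM : forall x y, K x -> K y -> K (x * y);
  subV : forall x, K x -> K x^-1 }.

Record normal_in A K : Prop := NormalIn {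
  nsub : forall x, K x -> A x;
  ngrp : subgroup_of K;
  nconj : forall a x, A a -> K x -> K (x ^ a) }.

Definition cong K a b : Prop := K (a^-1 * b).

Lemma cong_refl A K a : normal_in A K -> cong K a a.
Proof. by move=> nK; rewrite /cong mulVg; exact: sub1 (ngrp nK). Qed.

Lemma cong_sym A K a b : normal_in A K -> cong K a b -> cong K b a.
Proof. by move=> nK /(subV (ngrp nK)); rewrite /cong invgM invgK. Qed.

Lemma cong_trans A K a b c :
  normal_in A K -> cong K a b -> cong K b c -> cong K a c.
Proof.
by move=> nK ab /(subM (ngrp nK) ab); rewrite /cong mulgA mulgK.
Qed.

Lemma cong1 A K x : normal_in A K -> K x -> cong K 1 x.
Proof. by rewrite /cong invg1 mul1g. Qed.

(** Since [(a b)^-1 a' b'] equals [(a^-1 a')^b b^-1 b'], the only conjugation that occurs is by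
    [b]. *)
Lemma cong_mul A K a a' b b' : normal_in A K -> A b ->
  cong K a a' -> cong K b b' -> cong K (a * b) (a' * b').
Proof.
move=> nK Ab aa' /(subM (ngrp nK) (nconj nK Ab aa')).
by rewrite /cong conjgE invgM !mulgA mulgK.
Qed.

Lemma cong_mulIr A K a b c : subgroup_of A -> normal_in A K -> A c ->
  cong K (a * c) (b * c) -> cong K a b.
Proof.
move=> gA nK Ac /(nconj nK (subV gA Ac)).
by rewrite /cong conjgE invgM invgK !mulgA mulgV mul1g mulgK.
Qed.

Lemma normal_mulset A K L :
  subgroup_of A -> normal_in A K -> normal_in A L -> normal_in A (mulset K L).
Proof.
move=> gA nK nL; split.
- by move=> _ [k Kk [m Lm <-]]; apply: (subM gA);
    [exact: (nsub nK)|exact: (nsub nL)].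
- split.
  + exists 1; first exact: sub1 (ngrp nK).
    by exists 1; [exact: sub1 (ngrp nL)|rewrite mulg1].
  + move=> _ _ [k Kk [m Lm <-]] [k' Kk' [m' Lm' <-]].
    exists (k * k'); first exact: subM (ngrp nK) _ _ Kk Kk'.
    exists (m ^ k' * m'); last by rewrite conjgE -!mulgA mulKVg.
    by apply: (subM (ngrp nL)) => //; apply: (nconj nL) => //; exact: (nsub nK).
  + move=> _ [k Kk [m Lm <-]]; exists k^-1; first exact: subV (ngrp nK) _ Kk.
    exists (m^-1 ^ k^-1); last by rewrite conjgE invgK mulKg invgM.
    by apply: (nconj nL); [apply: (subV gA);
      exact: (nsub nK)|exact: subV (ngrp nL) _ Lm].
- move=> a _ Aa [k Kk [m Lm <-]]; exists (k ^ a); first exact: (nconj nK).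
  by exists (m ^ a); [exact: (nconj nL)|rewrite conjMg].
Qed.

Lemma mulset_l A K L x : normal_in A L -> K x -> mulset K L x.
Proof.
by move=> nL Kx; exists x => //; exists 1;
  [exact: sub1 (ngrp nL)|rewrite mulg1].
Qed.

Lemma mulset_r A K L x : normal_in A K -> L x -> mulset K L x.
Proof.
by move=> nK Lx; exists 1; [exact: sub1 (ngrp nK)|exists x; rewrite ?mul1g].
Qed.

Lemma normalI A K L :
  normal_in A K -> normal_in A L -> normal_in A (K `&` L)%classic.
Proof.
move=> nK nL; split; first by move=> x [/(nsub nK)].
  split; first by split; [exact: sub1 (ngrp nK)|exact: sub1 (ngrp nL)].
    by move=> x y [? ?] [? ?]; split;
      [exact: subM (ngrp nK) _ _ _ _|exact: subM (ngrp nL) _ _ _ _].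
  by move=> x [? ?]; split;
    [exact: subV (ngrp nK) _ _|exact: subV (ngrp nL) _ _].
by move=> a x Aa [? ?]; split; [exact: (nconj nK)|exact: (nconj nL)].
Qed.

Lemma normal_vanishing A (P : int -> Prop) : subgroup_of A ->
  normal_in A [set a | A a /\ forall s, P s -> a s = 1]%classic.
Proof.
move=> gA; split; first by move=> x [].
- split; first by split => //; exact: sub1 gA.
  + move=> x y [Ax x1] [Ay y1]; split; first exact: subM gA _ _ Ax Ay.
    by move=> s Ps; rewrite -[LHS]/(x s * y s) x1 // y1 // mulg1.
  + move=> x [Ax x1]; split; first exact: subV gA _ Ax.
    by move=> s Ps; rewrite -[LHS]/((x s)^-1) x1 // invg1.
- move=> a x Aa [Ax x1]; split.
    by rewrite conjgE; apply: (subM gA);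
      [exact: subV gA _ Aa|exact: subM gA _ _ Ax Aa].
  move=> s Ps; rewrite -[LHS]/((a s)^-1 * (x s * a s)) x1 // mul1g.
  exact: mulVg.
Qed.

(** The neutral element given by [group_on] is idempotent, hence the identity sequence, so inverses
    agree too. *)
Lemma group_on_subgroup A :
  group_on A (fun a b => a * b) -> subgroup_of A.
Proof.
move=> [AM _ [e Ae eP]]; have e1 : e = 1 by have [ee _ _] := eP e Ae;
  by apply: (mulIg e); rewrite ee mul1g.
subst e; split => // x Ax; have [_ _ [y [Ay yx _]]] := eP x Ax.
by rewrite -[x^-1]mul1g -yx mulgK.
Qed.

End Congruence.

(** * Products of generators, sorted by starting time *)

Section GeneratorSequences.
Variables (l : nat) (Alph : int -> finGroupType) (A : set (sequences Alph)).
Variable B : 'I_l.+1 -> int -> set (sequences Alph).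
Hypothesis A_group_system : group_system A.
Hypothesis A_controllable : controllable l A.
Hypothesis A_complete : complete_system A.
Hypothesis B_basis : is_basis A B.
Implicit Types (r : gen_prod B) (a b : sequences Alph) (s t T i : int)
  (m : 'I_l.+1).

Local Open Scope ring_scope.

Let gA : subgroup_of A := group_on_subgroup A_group_system.1.

Lemma normal_Xset t : normal_in A (Xset A t).
Proof. exact: (normal_vanishing (fun s => s < t)). Qed.

Lemma normal_Yset t : normal_in A (Yset A t).
Proof. exact: (normal_vanishing (fun s => t < s)). Qed.

Lemma generator_in r m i : A (sval (r m i)).
Proof.
by have [_ BA _] := B_basis m i; have [] := BA _ (set_mem (svalP (r m i))).
Qed.

Lemma generator_support r m i s :
  ~~ (i <= s <= i + m%:Z) -> sval (r m i) s = 1%g.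
Proof.
by have [_ BA _] := B_basis m i; have [_] := BA _ (set_mem (svalP (r m i)));
  apply.
Qed.

Definition gen_one m i : B m i :=
  exist _ 1%g (mem_set (let: And3 _ _ B1 := B_basis m i in B1)).

Definition gen_from T r : gen_prod B :=
  fun m i => if T <= i then r m i else gen_one m i.

Definition gen_before T r : gen_prod B :=
  fun m i => if i < T then r m i else gen_one m i.

(** [alpha r] is the infinite product of the blocks, with starting times decreasing from left to
    right. *)
Definition block r i : sequences Alph := (\prod_(m < l.+1) sval (r m i))%g.

Lemma block_eval r i s : block r i s = (\prod_(m < l.+1) sval (r m i) s)%g.
Proof. exact: (big_morph (fun a : sequences Alph => a s)). Qed.

Lemma block_in r i : A (block r i).
Proof.
by apply: big_ind => [|x y|m _];
  [exact: sub1 gA|exact: subM gA _ _|exact: generator_in].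
Qed.

(** A generator that starts at [t - j] with length below [j] is over at time [t], so the inner
    product may run over all lengths. *)
Lemma alpha_block r t :
  alpha r t = (\prod_(j < l.+1) block r (t - (j : nat)%:Z) t)%g.
Proof.
apply: eq_bigr => j _; rewrite block_eval big_mkcond /=.
apply: eq_bigr => m _; case: leqP => // mj.
by rewrite generator_support //; lia.
Qed.

Lemma eq_alpha r r' s :
  (forall m i, i <= s <= i + m%:Z -> r m i = r' m i) ->
  alpha r s = alpha r' s.
Proof.
move=> rr'; apply: eq_bigr => j _; apply: eq_bigr => m jm.
by rewrite rr' //; lia.
Qed.

Lemma alpha_one s : alpha gen_one s = 1%g.
Proof. by apply: big1 => j _; apply: big1. Qed.

(** At each time the starting times decrease along the product, so the generators starting from [T]
    on form an initial segment. *)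
Lemma alpha_split T r :
  alpha r = (alpha (gen_from T r) * alpha (gen_before T r))%g.
Proof.
apply: functional_extensionality_dep => t.
change (alpha r t = alpha (gen_from T r) t * alpha (gen_before T r) t)%g.
rewrite !alpha_block (@prod_split_downset _ _ (fun j => T <= t - j%:Z));
  last first.
  by move=> i j; lia.
congr (_ * _)%g; rewrite big_mkcond; apply: eq_bigr => j _ /=.
  rewrite !block_eval; case: ifP => jT.
    by apply: eq_bigr => m _; rewrite /gen_from jT.
  by rewrite big1 // => m _; rewrite /gen_from jT.
rewrite -ltNge !block_eval; case: ifP => jT.
  by apply: eq_bigr => m _; rewrite /gen_before jT.
by rewrite big1 // => m _; rewrite /gen_before jT.
Qed.

Lemma alpha_single T r :
  (forall m i, i != T -> r m i = gen_one m i) -> alpha r = block r T.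
Proof.
move=> rT; apply: functional_extensionality_dep => s.
rewrite alpha_block.
have [sT|sT] := boolP (T <= s <= T + l%:Z); last first.
  rewrite block_eval !big1 // => [m _|j _].
    by rewrite generator_support //; have := ltn_ord m; lia.
  rewrite block_eval big1 // => m _; rewrite rT //.
  by have := ltn_ord j; lia.
have jP : (`|s - T| < l.+1)%N by lia.
rewrite (prod_split_at (Ordinal jP)) /= !big1 ?mul1g ?mulg1.
- by congr (block r _ s); lia.
- move=> j jc; rewrite block_eval big1 // => m _; rewrite rT //.
  by lia.
- move=> j jc; rewrite block_eval big1 // => m _; rewrite rT //.
  by lia.
Qed.

Lemma alpha_before_recr T r :
  alpha (gen_before (T + 1) r) = (block r T * alpha (gen_before T r))%g.
Proof.
rewrite (alpha_split T) (@alpha_single T); last first.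
  by move=> m i iT; rewrite /gen_from /gen_before; do 2 case: ifP => //; lia.
congr (_ * _)%g.
  by apply: eq_bigr => m _; rewrite /gen_from /gen_before lexx ltrDl.
congr alpha; apply: functional_extensionality_dep => m.
apply: functional_extensionality_dep => i.
by rewrite /gen_before; case: ifP => // iT; rewrite ifT //; lia.
Qed.

Lemma alpha_from_recl T r :
  alpha (gen_from T r) = (alpha (gen_from (T + 1) r) * block r T)%g.
Proof.
rewrite (alpha_split (T + 1)) (@alpha_single T (gen_before _ _)); last first.
  by move=> m i iT; rewrite /gen_from /gen_before; do 2 case: ifP => //; lia.
congr (_ * _)%g; last first.
  by apply: eq_bigr => m _; rewrite /gen_from /gen_before lexx ltrDl.
congr alpha; apply: functional_extensionality_dep => m.
apply: functional_extensionality_dep => i.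
by rewrite /gen_from; case: ifP => // iT; rewrite ifT //; lia.
Qed.

(** By completeness it suffices to match [alpha r] on finite windows, where only finitely many
    blocks are visible. *)
Lemma alpha_in r : A (alpha r).
Proof.
apply: A_complete => T T'.
(* Generators starting before [T - l] are over before [T], so blocks are added from there on. *)
have fin N : exists2 a, A a &
    forall t, T <= t -> a t = alpha (gen_before (T - l%:Z + N%:Z) r) t.
  elim: N => [|N [a Aa aE]].
    exists 1%g => [|t Tt]; first exact: sub1 gA.
    rewrite -[LHS](alpha_one t); apply: eq_alpha => k i ti.
    by rewrite /gen_before ifF //; have := ltn_ord k; lia.
  exists (block r (T - l%:Z + N%:Z) * a)%g.
    by apply: (subM gA) => //; exact: block_in.
  move=> t Tt; rewrite -addn1 PoszD addrA alpha_before_recr.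
  by congr (_ * _)%g; exact: aE.
(* Enough blocks to include every starting time up to [T']. *)
have [a Aa aE] := fin (absz (T' - (T - l%:Z) + 1));
  exists a => // t /andP[Tt tT'].
rewrite aE //; apply: eq_alpha => k i ti; rewrite /gen_before ifT //.
by lia.
Qed.

Lemma alpha_from_in T r : Xset A T (alpha (gen_from T r)).
Proof.
split=> [|s sT]; first exact: alpha_in.
rewrite -(alpha_one s); apply: eq_alpha => m i ti.
by rewrite /gen_from ifF //; lia.
Qed.

(** * Recovering a generator from its coset *)

(* The filtration [X^{T+1} = chain T 0 <= ... <= chain T (l+1) = X^T], whose
   factors are the [Lambda^[T,T+c]]. *)
Definition chain T (c : nat) : set (sequences Alph) :=
  mulset (Xset A (T + 1)) (Xset A T `&` Yset A (T + c%:Z - 1)).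

Lemma normal_chain_right T t : normal_in A (Xset A T `&` Yset A t)%classic.
Proof. by apply: normalI; [exact: normal_Xset|exact: normal_Yset]. Qed.

Lemma normal_chain T c : normal_in A (chain T c).
Proof.
by apply: normal_mulset => //; [exact: normal_Xset|exact: normal_chain_right].
Qed.

Lemma LambdaE T c : Lambda A T c = cosets (chain T c.+1) (chain T c).
Proof. by rewrite /Lambda /chain -addn1 PoszD addrA addrK. Qed.

Lemma basis_inj T m g g' :
  B m T g -> B m T g' -> cong (chain T m) g g' -> g = g'.
Proof.
move=> Bg Bg' gg'; have [[BL LB] _ _] := B_basis m T.
have [c Lc cg] := BL g Bg; have [h [_ hu]] := LB c Lc.
rewrite -(hu g) // -(hu g') //; split => //.
move: Lc cg; rewrite LambdaE => -[a _ <-] [k Ck kE].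
exists (k * (g^-1 * g'))%g;
  first exact: subM (ngrp (normal_chain T m)) _ _ Ck gg'.
by rewrite mulgA kE mulKVg.
Qed.

Lemma basis_surj T m h : chain T m.+1 h ->
  exists g : B m T, chain T m (h * (sval g)^-1)%g.
Proof.
move=> Ch; have [[_ LB] _ _] := B_basis m T.
have nC := normal_chain T m.
have [|g [[Bg [k Ck kE]] _]] := LB (left_coset h (chain T m)).
  by rewrite LambdaE; exists h.
exists (exist _ g (mem_set Bg)) => /=.
have -> : (h * g^-1 = k^-1 ^ h^-1)%g by rewrite -kE conjgE invgK invgM !mulgA.
apply: (nconj nC); last exact: subV (ngrp nC) _ Ck.
by apply: (subV gA); exact: nsub (normal_chain T m.+1) _ Ch.
Qed.

Lemma block_split r T m :
  block r T = ((\prod_(k < l.+1 | (k < m)%N) sval (r k T)) * sval (r m T) *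
     \prod_(k < l.+1 | (m < k)%N) sval (r k T))%g.
Proof. exact: prod_split_at. Qed.

(** The longer generators stand on the right and cancel; the shorter ones lie in [chain T m]. Hence
    the generators of length [m] are congruent, and the transversal makes them equal. *)
Lemma block_cong_inj r r' T m :
  (forall k : 'I_l.+1, (m < k)%N -> r k T = r' k T) ->
  cong (chain T m) (block r T) (block r' T) -> r m T = r' m T.
Proof.
move=> rr' rC; apply: val_inj; apply: (@basis_inj T m).
- exact: set_mem (svalP (r m T)).
- exact: set_mem (svalP (r' m T)).
have nC := normal_chain T m.
have low r0 : chain T m (\prod_(k < l.+1 | (k < m)%N) sval (r0 k T))%g.
  apply: big_ind => [|x y|k km];
    [exact: sub1 (ngrp nC)|exact: subM (ngrp nC) _ _|].
  apply: mulset_r; first exact: normal_Xset.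
  by split; split=> [|s sT]; rewrite ?generator_support //;
    first [exact: generator_in|lia].
move: rC; rewrite (block_split r T m) (block_split r' T m).
rewrite (eq_bigr (fun k => sval (r' k T)) (P := fun k : 'I_l.+1 => (m < k)%N));
  last first.
  by move=> k mk; rewrite rr'.
move/(cong_mulIr gA nC) => C.
have {C} : cong (chain T m)
    (\prod_(k < l.+1 | (k < m)%N) sval (r k T) * sval (r m T))%g
    (\prod_(k < l.+1 | (k < m)%N) sval (r' k T) * sval (r' m T))%g.
  by apply: C; apply: big_ind => [|x y|k km];
    [exact: sub1 gA|exact: subM gA _ _|exact: generator_in].
move=> C; have Ag := generator_in r m T; have Ag' := generator_in r' m T.
have c1 := cong_mul nC Ag (cong1 nC (low r)) (cong_refl (sval (r m T)) nC).
have c2 := cong_mul nC Ag' (cong1 nC (low r')) (cong_refl (sval (r' m T)) nC).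
rewrite !mul1g in c1 c2.
by apply: (cong_trans nC c1); apply: (cong_trans nC C); exact: cong_sym nC c2.
Qed.

(** * Triangles and the normal subgroups [X^{t+1} Y^{t+k-1}] *)

Lemma alpha_cong r r' k t :
  (forall m i, i <= t -> t + k%:Z <= i + m%:Z -> r m i = r' m i) ->
  cong (mulset (Xset A (t + 1)) (Yset A (t + k%:Z - 1))) (alpha r) (alpha r').
Proof.
move=> rr'; rewrite (alpha_split (t + 1) r) (alpha_split (t + 1) r').
have nX := normal_Xset (t + 1); have nY := normal_Yset (t + k%:Z - 1).
have nN := normal_mulset gA nX nY.
apply: (cong_mul nN); first exact: alpha_in.
  apply: (mulset_l nY); apply: (subM (ngrp nX)); last exact: alpha_from_in.
  by apply: (subV (ngrp nX)); exact: alpha_from_in.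
apply: (mulset_r nX); split.
  by apply: (subM gA); [apply: (subV gA)|]; exact: alpha_in.
move=> s ts; set Q := alpha _; set Q' := alpha _.
rewrite -[LHS]/((Q s)^-1 * Q' s)%g (_ : Q' s = Q s) ?mulVg //.
(* A generator that starts by [t] and is active at a time [s >= t + k] belongs to the triangle. *)
apply: eq_alpha => m i si; rewrite /gen_before; case: ifP => // it.
by rewrite rr' //; lia.
Qed.

(* Descending induction on the generator length [n]: once the longer generators
   agree, the two factorisations at time [T] differ by an element of
   [X^T :&: Y^{T+n-1}], which is invisible in [Lambda^[T,T+n]]. *)
Lemma alpha_cong_inj r r' k t :
  cong (mulset (Xset A (t + 1)) (Yset A (t + k%:Z - 1))) (alpha r) (alpha r') ->
  forall m i, i <= t -> t + k%:Z <= i + m%:Z -> r m i = r' m i.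
Proof.
move=> [x Xx [y Yy xyE]].
have {}xyE : alpha r' = (alpha r * (x * y))%g by rewrite xyE mulKVg.
suff agree d : forall m i, (l < m + d)%N -> i <= t -> t + k%:Z <= i + m%:Z ->
    r m i = r' m i.
  by move=> m i; apply: (agree l.+1); lia.
elim: d => [|d IH] m T; first by have := ltn_ord m; lia.
move=> md Tt tTm; apply: block_cong_inj => [j mj|].
  by apply: IH => //; lia.
set P := alpha (gen_from T r); set Q := alpha (gen_before T r).
set P' := alpha (gen_from T r'); set Q' := alpha (gen_before T r').
have nC := normal_chain T m.
have AP : A P := alpha_in _; have AP' : A P' := alpha_in _.
have AQ : A Q := alpha_in _; have AQ' : A Q' := alpha_in _.
have APQ : A (P * Q)^-1%g by apply: (subV gA); exact: (subM gA).
(* Moving [x] to the front and [y] across [Q] turns [P' Q' = P Q x y] into [P' Q' = x' P y' Q]; [D]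
   absorbs [y' Q Q'^-1]. *)
have [Ax' x'1] := nconj (normal_Xset (t + 1)) APQ Xx.
have [Ay' y'1] := nconj (normal_Yset (t + k%:Z - 1)) (subV gA AQ) Yy.
set x' := (x ^ _)%g in Ax' x'1; set y' := (y ^ _)%g in Ay' y'1.
pose D := (y' * (Q * Q'^-1))%g.
have P'E : P' = (x' * P * D)%g.
  apply: (mulIg Q'); rewrite -alpha_split xyE (alpha_split T r) -/P -/Q.
  rewrite /D /x' /y' !conjgE !invgK !mulgA mulgVK.
  by rewrite invgM !mulgA !mulgVK.
have CD : chain T m D.
  apply: mulset_r; first exact: normal_Xset.
  have AD : A D by apply: (subM gA) => //; apply: (subM gA) => //;
    exact: (subV gA).
  split; split=> // s sT.
    (* Before [T] the factors [P], [P'] and [x'] are trivial, which forces [D] to be trivial. *)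
    have P1 : P s = 1%g := (alpha_from_in T r).2 s sT.
    have P'1 : P' s = 1%g := (alpha_from_in T r').2 s sT.
    have /(congr1 (fun a : sequences Alph => a s)) := P'E.
    rewrite -[LHS]/(P' s) P'1 -[RHS]/(x' s * P s * D s)%g P1 mulg1.
    by rewrite x'1 ?mul1g; [move=> <-|lia].
  (* From [T + m] on [y'] is trivial, and the generators started before [T] that are still active
     are longer than [m], so [IH] equates [Q] and [Q'] there. *)
  rewrite -[LHS]/(y' s * (Q s * (Q' s)^-1))%g y'1 ?mul1g; last by lia.
  rewrite (_ : Q' s = Q s) ?mulgV //; apply: eq_alpha => j i si.
  by rewrite /gen_before; case: ifP => // iT; rewrite IH //; lia.
have CX z : Xset A (T + 1) z -> chain T m z.
  by move=> Xz; apply: mulset_l Xz; exact: normal_chain_right.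
have Cx' : chain T m x' by apply: CX; split => // s sT; apply: x'1; lia.
(* Generators starting after [T] contribute a factor in [X^{T+1}], which [chain T m] contains. *)
have Pb r0 : cong (chain T m) (block r0 T) (alpha (gen_from T r0)).
  rewrite alpha_from_recl -[X in cong _ X]mul1g.
  apply: (cong_mul nC); [exact: block_in| |exact: (cong_refl _ nC)].
  by apply: (cong1 nC); apply: CX; exact: alpha_from_in.
apply: (cong_trans nC (Pb r)); apply: (cong_trans nC _ (cong_sym nC (Pb r'))).
rewrite -/P -/P' P'E -[X in cong _ X]mulg1 -[X in cong _ (X * _)%g]mul1g.
apply: (cong_mul nC); [exact: sub1 gA| |exact: (cong1 nC)].
by apply: (cong_mul nC) => //; [exact: (cong1 nC)|exact: (cong_refl _ nC)].
Qed.

(** Every index [(m, i)] lies in the triangle with [k = 0] at time [i]. *)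
Lemma alpha_inj r r' : alpha r = alpha r' -> r = r'.
Proof.
move=> rr'; apply: functional_extensionality_dep => m.
apply: functional_extensionality_dep => i.
have nN := normal_mulset gA (normal_Xset (i + 1)) (normal_Yset (i + 0 - 1)).
apply: (@alpha_cong_inj r r' 0 i) => //; last by lia.
by rewrite rr'; exact: (cong_refl _ nN).
Qed.

(** * Surjectivity of [alpha] *)

(* [r] lists the generators of length at least [c]; the product of those
   starting before [T] already gives [a], up to a factor in [X^T], at all times
   at least [T+c-1]. *)
Definition partial_encoding a (c : nat) r (p : int -> sequences Alph) : Prop :=
  (forall m i, (m < c)%N -> r m i = gen_one m i) /\
  forall T, [/\ Xset A T (p T),
    forall s, T + c%:Z - 1 <= s -> a s = (p T s * alpha (gen_before T r) s)%g &
    chain T c (p T * (block r T)^-1)%g].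

(** All generators are still trivial here; controllability supplies [p T], trivial before [T] and
    equal to [a] from [T + l] on. *)
Lemma partial_encoding_start a : A a ->
  exists p, partial_encoding a l.+1 gen_one p.
Proof.
move=> Aa; have A1 := sub1 gA.
have ex T : exists p, Xset A T p /\ forall s, T + l%:Z <= s -> a s = p s.
  have [b [Ab b1 b2]] := A_controllable T A1 Aa.
  by exists b; split=> // s /b2.
have [p pP] := choice ex; exists p; split=> [//|T]; have [[Ap p1] pa] := pP T.
split=> //.
- move=> s Ts; rewrite pa; last by lia.
  by rewrite -[LHS]mulg1 -(alpha_one s); congr (_ * _)%g;
    apply: eq_alpha => m i _;
     rewrite /gen_before; case: ifP.
rewrite (_ : block _ _ = 1%g); last exact: big1.
rewrite invg1 mulg1.
(* Second use of controllability: [z] agrees with [p T] up to [T] and is over after [T + l], so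
   [p T] lies in [chain T l.+1]. *)
have [z [Az z1 z2]] := A_controllable (T + 1) Ap A1.
exists (p T * z^-1)%g; last exists z.
- split; first by apply: (subM gA) => //; exact: (subV gA).
  by move=> s sT; rewrite -[LHS]/(p T s * (z s)^-1)%g z1 // mulgV.
- split; split=> // s sT; last by rewrite z2 //; lia.
  by rewrite z1 ?p1 //; lia.
- by rewrite mulgVK.
Qed.

(** The coset of [p T] times [(block r T)^-1] in [Lambda^[T,T+c]] dictates the generator [g T] of
    length [c]. The remainder [x T] starts after [T] and serves as the new [p] at [T + 1]. *)
Lemma partial_encoding_step a (c : 'I_l.+1) r p :
  A a -> partial_encoding a c.+1 r p ->
  exists r' p', partial_encoding a c r' p'.
Proof.
move=> Aa [r1 pP].
have ex T : exists gx : B c T * sequences Alph, Xset A (T + 1) gx.2 /\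
    exists2 z, (Xset A T `&` Yset A (T + c%:Z - 1))%classic z &
      p T = (gx.2 * z * sval gx.1 * block r T)%g.
  have [_ _ /basis_surj[g [x Xx [z Zz xzE]]]] := pP T.
  exists (g, x); split=> //=; exists z => //.
  by rewrite xzE !mulgVK.
have r1c m i : (m < c)%N -> m != c /\ r m i = gen_one m i.
  move=> mc; rewrite r1 ?ltnS 1?ltnW //; split=> //.
  by apply: contraTneq mc => ->; rewrite ltnn.
pose g T := (sval (cid (ex T))).1; pose x T := (sval (cid (ex T))).2.
have xP T : Xset A (T + 1) (x T) by have [] := svalP (cid (ex T)).
have gP T : exists2 z, (Xset A T `&` Yset A (T + c%:Z - 1))%classic z &
    p T = (x T * z * sval (g T) * block r T)%g.
  by have [] := svalP (cid (ex T)).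
(* The type of a generator depends on its length, hence the transport along [c = m]. *)
pose r' : gen_prod B := fun m i =>
  match @eqP _ c m with ReflectT e => ecast j (B j i) e (g i) | _ => r m i end.
have r'c i : r' c i = g i.
  by rewrite /r'; case: eqP => // e; rewrite eq_axiomK.
have r'nc m i : m != c -> r' m i = r m i.
  by rewrite /r' eq_sym; case: eqP.
have r'1 m i : (m < c)%N -> r' m i = gen_one m i.
  by move=> /(r1c _ i)[mc <-]; exact: r'nc.
have bE T : block r' T = (sval (g T) * block r T)%g.
  have low r0 : (forall m i, (m < c)%N -> r0 m i = gen_one m i) ->
      (\prod_(k < l.+1 | (k < c)%N) sval (r0 k T) = 1)%g.
    by move=> r01; apply: big1 => m mc; rewrite r01.
  rewrite (block_split r' T c) (block_split r T c) r'c r1 ?ltnSn //.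
  rewrite !low ?mul1g // => [|m i mc]; last by rewrite r1 // ltnW.
  congr (_ * _)%g; apply: eq_bigr => m cm; rewrite r'nc //.
  by apply: contraTneq cm => ->; rewrite ltnn.
(* The new generators starting before [T] have length [c] and are over before [T + c]. *)
have aE T s : T + c%:Z <= s ->
    alpha (gen_before T r') s = alpha (gen_before T r) s.
  move=> Ts; apply: eq_alpha => m i si; rewrite /gen_before; case: ifP => // iT.
  by rewrite r'nc // -val_eqE /=; lia.
have axE T s : T + c%:Z <= s ->
    a s = (x T s * alpha (gen_before (T + 1) r') s)%g.
  move=> Ts; have [_ pa _] := pP T; have [z [_ [_ z1]] pE] := gP T.
  rewrite pa ?pE; last by lia.
  rewrite alpha_before_recr bE -aE // -[LHS]/(x T s * z s * sval (g T) s *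
    block r T s * alpha (gen_before T r') s)%g.
  by rewrite z1 ?mulg1; [rewrite -!mulgA|lia].
exists r', (fun T => x (T - 1)); split=> [//|T].
have T1 : T - 1 + 1 = T by lia.
have XxT : Xset A T (x (T - 1)) by have := xP (T - 1); rewrite T1.
split=> //.
  by move=> s Ts; have := @axE (T - 1) s; rewrite T1; apply; lia.
have [Xp pa _] := pP T; have [z Zz pE] := gP T.
have nC := normal_chain T c.
(* From [T + c] on, [p T] and [x (T - 1)] both complete the same product to [a], so their quotient
   lies in [Y^{T+c-1}]. *)
have CD : chain T c ((p T)^-1 * x (T - 1))%g.
  apply: mulset_r; first exact: normal_Xset.
  have nX := normal_Xset T.
  have [AD D1] : Xset A T ((p T)^-1 * x (T - 1))%g.
    by apply: (subM (ngrp nX)) => //; exact: (subV (ngrp nX)).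
  split; split=> // s Ts.
  rewrite -[LHS]/((p T s)^-1 * x (T - 1) s)%g.
  have := @axE (T - 1) s; rewrite T1 aE; last by lia.
  rewrite pa; last by lia.
  by move/(_ _)/mulIg => ->; [rewrite mulVg|lia].
have Cxz : chain T c (x T * z)%g by exists (x T) => //; exists z.
rewrite (_ : (x (T - 1) * _ = (x T * z) *
   ((p T)^-1 * x (T - 1)) ^ (block r' T)^-1)%g).
  by apply: (subM (ngrp nC)) => //; apply: (nconj nC) => //; apply: (subV gA);
    exact: block_in.
rewrite conjgE invgK pE -[(_ * _ * block r T)%g]mulgA -bE !invgM !mulgA.
by rewrite !mulgK mulgV mul1g.
Qed.

Lemma alpha_surj a : A a -> exists r, alpha r = a.
Proof.
move=> Aa.
have dec d : (d <= l.+1)%N -> exists r p, partial_encoding a (l.+1 - d) r p.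
  elim: d => [|d IH] dl.
    by have [p] := partial_encoding_start Aa; rewrite subn0; exists gen_one, p.
  have [r [p rp]] := IH (ltnW dl).
  have cl : (l.+1 - d.+1 < l.+1)%N by lia.
  apply: (@partial_encoding_step a (Ordinal cl) r p) => //=.
  by rewrite -subSn // subSS.
have [r [p]] := dec _ (leqnn _); rewrite subnn => -[_ rp].
exists r; apply: functional_extensionality_dep => s.
(* At [c = 0] the encoding holds from [T - 1] on; [T = s + 1] is chosen because [p T] is still
   trivial at [s]. *)
have [[_ p1] pa _] := rp (s + 1).
rewrite pa; last by lia.
rewrite p1 ?mul1g; last by lia.
by apply: eq_alpha => m i si; rewrite /gen_before ifT //; lia.
Qed.

End GeneratorSequences.

(** * Operations induced along a map *)

(** By hypothesis all representatives that [xget] may pick give the same value; its default is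
    excluded by [x1] and [x2] themselves. *)
Lemma induced_opE (T : Type) (T' : choiceType) (f : T -> T') (op : T -> T -> T)
    (x1 x2 : T) :
  (forall y1 y2, f y1 = f x1 -> f y2 = f x2 -> f (op y1 y2) = f (op x1 x2)) ->
  induced_op f op (f x1) (f x2) = f (op x1 x2).
Proof.
move=> f_op; rewrite /induced_op.
case: xgetP => [y _ [y1 [y2 [y1E y2E ->]]]|nex]; first exact: f_op.
by case: (nex (f (op x1 x2))); exists x1, x2.
Qed.

Lemma group_on_induced (T : Type) (T' : choiceType) (f : T -> T')
    (op : T -> T -> T) :
  (forall x1 x2 y1 y2, f y1 = f x1 -> f y2 = f x2 ->
     f (op y1 y2) = f (op x1 x2)) ->
  group_on setT op -> group_on (range f) (induced_op f op).
Proof.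
move=> f_op [_ opA [e _ eP]].
have opE x1 x2 : induced_op f op (f x1) (f x2) = f (op x1 x2).
  by apply: induced_opE => *; exact: f_op.
split.
- by move=> _ _ [x _ <-] [y _ <-]; rewrite opE; exists (op x y).
- by move=> _ _ _ [x _ <-] [y _ <-] [z _ <-]; rewrite !opE opA.
- exists (f e); first by exists e.
  move=> _ [x _ <-]; have [ex xe [y [_ yx xy]]] := eP x I.
  rewrite !opE ex xe; split=> //; exists (f y).
  by rewrite !opE yx xy; split=> //; exists y.
Qed.

(** * The elementary system of an operation that respects triangles *)

Section TriangleCongruences.
Variables (l : nat) (V : 'I_l.+1 -> int -> Type).

Local Open Scope ring_scope.

(** The triangle consists of the generators starting by [t] and ending at [t + k] or later; the
    index [j] in [Tri] is the delay [t - i]. *)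
Lemma eq_nabla (k : nat) (t : int) (v w : double_prod V) :
  nabla k t v = nabla k t w <->
  forall (m : 'I_l.+1) (i : int), i <= t -> t + k%:Z <= i + m%:Z ->
    v m i = w m i.
Proof.
split=> [vw m i it tm|vw].
  have H : Tri k t (m, i).
    apply/existsP; have jl : (absz (t - i)%R < (l - k).+1)%N.
      by have := ltn_ord m; lia.
    by exists (Ordinal jl); rewrite /=; apply/andP; split; lia.
  exact: (congr1 (fun x : triangle V k t => x (exist _ (m, i) H)) vw).
apply: functional_extensionality_dep => -[[m i] /= H]; apply: vw => /=.
  by have /existsP[j /andP[/eqP /= -> _]] := H; lia.
by have /existsP[j /andP[/eqP /= -> /= kjm]] := H; lia.
Qed.

Variable op : double_prod V -> double_prod V -> double_prod V.
Hypothesis op_group : group_on setT op.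
Hypothesis nabla_op : forall k t u1 u2 v1 v2,
  nabla k t v1 = nabla k t u1 -> nabla k t v2 = nabla k t u2 ->
  nabla k t (op v1 v2) = nabla k t (op u1 u2).

Let upper : list_op V := fun k t => induced_op (@nabla l V k t) op.

Lemma induced_nablaE k t u1 u2 :
  upper (nabla k t u1) (nabla k t u2) = nabla k t (op u1 u2).
Proof. by apply: induced_opE => v1 v2; exact: nabla_op. Qed.

(** Both projections only restrict the triangle of one [v], so the homomorphism law is
    [induced_nablaE] for two triangles of the same product. *)
Lemma induced_elementary_system : elementary_system upper.
Proof.
split=> [k t _|k t kl].
  by apply: group_on_induced => // *; exact: nabla_op.
split; split.
- by move=> _ [v _ <-]; exists v.
- by move=> _ _ [v _ <-] [w _ <-]; rewrite induced_nablaE;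
    exact/esym/(induced_nablaE _ _ v w).
- by move=> _ [v _ <-]; exists v.
- by move=> _ _ [v _ <-] [w _ <-]; rewrite induced_nablaE;
    exact/esym/(induced_nablaE _ _ v w).
Qed.

(** [op u1 u2] itself satisfies the equations that define the global product, and uniqueness
    identifies the two. *)
Lemma global_op_induced u1 u2 : global_op upper u1 u2 = op u1 u2.
Proof.
have uP := induced_elementary_system.
have [v [_ vu]] := global_product_unique uP u1 u2.
rewrite -(vu _ (global_opP uP u1 u2)); apply: vu => t.
by rewrite induced_nablaE.
Qed.

End TriangleCongruences.

(** * The generator group *)

Section GeneratorOperation.
Variables (l : nat) (Alph : int -> finGroupType) (A : set (sequences Alph)).
Variable B : 'I_l.+1 -> int -> set (sequences Alph).
Hypothesis A_group_system : group_system A.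
Hypothesis A_controllable : controllable l A.
Hypothesis A_complete : complete_system A.
Hypothesis B_basis : is_basis A B.
Implicit Types r : gen_prod B.

Local Open Scope ring_scope.

Let gA : subgroup_of A := group_on_subgroup A_group_system.1.
Let alphaA r : A (alpha r) := alpha_in A_group_system A_complete B_basis r.
Let alphaI r r' : alpha r = alpha r' -> r = r'.
Proof. exact: (alpha_inj A_group_system A_complete B_basis). Qed.
Let alpha_onto a (Aa : A a) : exists r, alpha r = a :=
  alpha_surj A_group_system A_controllable B_basis Aa.

Lemma alpha_gen_mul r1 r2 : alpha (gen_mul r1 r2) = (alpha r1 * alpha r2)%g.
Proof.
have /alpha_onto ex : A (alpha r1 * alpha r2)%g by exact: (subM gA).
exact: (@xgetPex _ r1 [set r | alpha r = (alpha r1 * alpha r2)%g]%classic ex).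
Qed.

Lemma gen_mul_group : group_on setT (@gen_mul l Alph B).
Proof.
split=> [//|x y z _ _ _|].
  by apply: alphaI; rewrite !alpha_gen_mul mulgA.
have [e e1] := alpha_onto (sub1 gA); exists e => // x _.
have [y yV] := alpha_onto (subV gA (alphaA x)).
split; try by apply: alphaI; rewrite alpha_gen_mul e1 ?mul1g ?mulg1.
by exists y; split=> //; apply: alphaI;
  rewrite alpha_gen_mul yV e1 ?mulVg ?mulgV.
Qed.

(** Equality of triangles is congruence of the sequences modulo [X^{t+1} Y^{t+k-1}], which
    multiplication respects. *)
Lemma nabla_gen_mul k t r1 r2 r1' r2' :
  nabla k t r1' = nabla k t r1 -> nabla k t r2' = nabla k t r2 ->
  nabla k t (gen_mul r1' r2') = nabla k t (gen_mul r1 r2).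
Proof.
have nN := normal_mulset gA (normal_Xset A_group_system (t + 1))
  (normal_Yset A_group_system (t + k%:Z - 1)).
move=> /eq_nabla n1 /eq_nabla n2; apply/eq_nabla.
apply: (alpha_cong_inj A_group_system A_complete B_basis).
rewrite !alpha_gen_mul; apply: (cong_mul nN) => //.
  exact: (alpha_cong A_group_system A_complete B_basis n1).
exact: (alpha_cong A_group_system A_complete B_basis n2).
Qed.

Variables (G : 'I_l.+1 -> int -> Type).
Variable lab : forall (k : 'I_l.+1) (t : int), set_type (B k t) -> G k t.
Hypothesis lab_bij : forall k t, bijective (@lab k t).

Lemma nabla_beta k t r r' :
  nabla k t (beta lab r) = nabla k t (beta lab r') <->
    nabla k t r = nabla k t r'.
Proof.
rewrite !eq_nabla; split=> rr' m i it tm; last by rewrite /beta rr'.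
exact: bij_inj (lab_bij m i) _ _ (rr' m i it tm).
Qed.

Lemma beta_inj : injective (beta lab).
Proof.
move=> r r' rr'; apply: functional_extensionality_dep => m.
apply: functional_extensionality_dep => i; apply: (bij_inj (lab_bij m i)).
exact: (congr1 (fun u : double_prod G => u m i) rr').
Qed.

Lemma beta_surj u : exists r, beta lab r = u.
Proof.
have ex m i : exists g, lab g = u m i.
  by have [f _ fK] := lab_bij m i; exists (f (u m i)).
exists (fun m i => sval (cid (ex m i))).
apply: functional_extensionality_dep => m.
apply: functional_extensionality_dep => i.
exact: svalP (cid (ex m i)).
Qed.

Lemma generator_op_beta r1 r2 :
  generator_op lab (beta lab r1) (beta lab r2) = beta lab (gen_mul r1 r2).
Proof. by apply: induced_opE => r1' r2' /beta_inj -> /beta_inj ->. Qed.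

Lemma generator_op_group : group_on setT (generator_op lab).
Proof.
have -> : setT = range (beta lab).
  by apply/esym; rewrite -subTset => u _; have [r <-] := beta_surj u; exists r.
apply: group_on_induced; last exact: gen_mul_group.
by move=> r1 r2 r1' r2' /beta_inj -> /beta_inj ->.
Qed.

Lemma nabla_generator_op k t u1 u2 v1 v2 :
  nabla k t v1 = nabla k t u1 -> nabla k t v2 = nabla k t u2 ->
  nabla k t (generator_op lab v1 v2) = nabla k t (generator_op lab u1 u2).
Proof.
have [r1 <-] := beta_surj u1; have [r2 <-] := beta_surj u2.
have [r1' <-] := beta_surj v1; have [r2' <-] := beta_surj v2.
move=> /nabla_beta n1 /nabla_beta n2; rewrite !generator_op_beta.
by apply/nabla_beta; exact: nabla_gen_mul.
Qed.

End GeneratorOperation.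

Theorem theorem74 (l : nat) (Alph : int -> finGroupType)
    (A : set (sequences Alph))
    (B : 'I_l.+1 -> int -> set (sequences Alph))
    (G : 'I_l.+1 -> int -> Type)
    (lab : forall (k : 'I_l.+1) (t : int), set_type (B k t) -> G k t)
    (l_gt0 : (0 < l)%N)
    (A_group_system : group_system A)
    (A_controllable : controllable l A)
    (A_complete : complete_system A)
    (B_basis : is_basis A B)
    (lab_bij : forall (k : 'I_l.+1) (t : int), bijective (lab k t)) :
  elementary_system (upper_op lab) /\
  (forall u1 u2 : double_prod G,
     global_op (upper_op lab) u1 u2 = generator_op lab u1 u2) /\
  group_isom (global_op (upper_op lab)) (generator_op lab) (fun u => u).
Proof.
have op_group := generator_op_group A_group_system A_controllable A_complete
  B_basis lab_bij.
have nabla_op := nabla_generator_op A_group_system A_controllable A_complete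
  B_basis lab_bij.
have globalE u1 u2 : global_op (upper_op lab) u1 u2 = generator_op lab u1 u2.
  exact: (global_op_induced op_group nabla_op).
split; first exact: (induced_elementary_system op_group nabla_op).
(* Equality of the operations reduces the isomorphism to the group law of the generator group. *)
split=> //; have -> : global_op (upper_op lab) = generator_op lab.
  by apply/funext => u1; apply/funext => u2.
by split=> //; exists id.
Qed.
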